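(* There is a universal constant $C>0$ such that for every $n\in\mathbb N$ and every $p\in[1,\infty]$ we have $\mathsf e(\ell_p^n)\le C\,n^{\max\{\frac12,\frac1p\}}$.
   Context: All vector spaces are over the real scalars, $1/\infty=0$. For a metric space $(\mathcal M,d_{\mathcal M})$, the Lipschitz extension modulus $\mathsf e(\mathcal M)\in[1,\infty]$ is the infimum over those $L\in[1,\infty]$ such that for every nonempty subset $\mathscr C\subseteq\mathcal M$, every Banach space $\mathbf Z$ and every Lipschitz function $f:\mathscr C\to\mathbf Z$ there is $F:\mathcal M\to\mathbf Z$ with $F|_{\mathscr C}=f$ whose Lipschitz constant on $\mathcal M$ is at most $L$ times the Lipschitz constant of $f$ on $\mathscr C$. *)

(* Defs.v *)
From HB Require Import structures.
From mathcomp Require Import all_boot all_order all_algebra.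
From mathcomp Require Import all_classical all_reals all_analysis.

Set Implicit Arguments.
Unset Strict Implicit.
Unset Printing Implicit Defensive.

Import Order.TTheory GRing.Theory Num.Theory.
Import numFieldNormedType.Exports.

Local Open Scope classical_set_scope.
Local Open Scope ring_scope.

Section lipschitz_extension.
Context {R : realType}.

(* The library's k.-lipschitz_A requires a normed domain; here the domain is
   an arbitrary metric space. *)
Definition lipschitz_with {M : metricType R} {Z : normedModType R}
    (K : R) (A : set M) (f : M -> Z) : Prop :=
  forall x y, A x -> A y -> `|f x - f y| <= K * mdist x y.

Definition is_lipschitz {M : metricType R} {Z : normedModType R}
    (A : set M) (f : M -> Z) : Prop :=
  exists2 K : R, 0 <= K & lipschitz_with K A f.

(* The value is +oo when f is not Lipschitz on A. *)
Definition lipschitz_constant {M : metricType R} {Z : normedModType R}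
    (A : set M) (f : M -> Z) : \bar R :=
  ereal_inf [set K%:E | K in [set K : R | 0 <= K /\ lipschitz_with K A f]].

(* A function on A is represented by a function on M of which only the values
   on A are used.  In the library +oo * 0 = 0, which is harmless for L = +oo:
   a function with Lipschitz constant 0 on A is constant on A. *)
Definition lipschitz_extension_bound (M : metricType R) (L : \bar R) : Prop :=
  forall (A : set M) (Z : completeNormedModType R) (f : M -> Z),
    A !=set0 -> is_lipschitz A f ->
    exists F : M -> Z,
      (forall x, A x -> F x = f x) /\
      (lipschitz_constant setT F <= L * lipschitz_constant A f)%E.

Definition lipschitz_extension_modulus (M : metricType R) : \bar R :=
  ereal_inf [set L : \bar R | (1 <= L)%E /\ lipschitz_extension_bound M L].

End lipschitz_extension.

(* Meaningful for 1 <= p only; the value at -oo is junk.  Locked because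
   unification is slow to fail when it unfolds powR. *)
HB.lock Definition lp_norm {R : realType} {n : nat} (p : \bar R)
    (x : 'rV[R]_n) : R :=
  match p with
  | r%:E => (\sum_(i < n) `|x 0 i| `^ r) `^ r^-1
  | +oo%E => \big[Num.max/0]_(i < n) `|x 0 i|
  | -oo%E => 0
  end.

Section lp_norm.
Context {R : realType} (n : nat).
Implicit Types (x y : 'rV[R]_n) (p : \bar R) (r : R).

Lemma lp_norm_ge0 p x : 0 <= lp_norm p x.
Proof.
rewrite lp_norm.unlock; case: p => [r| |] //=; first exact: powR_ge0.
by elim/big_ind: _ => // a b a0 b0; rewrite le_max a0.
Qed.

Lemma lp_norm0 p : (1 <= p)%E -> lp_norm p (0 : 'rV[R]_n) = 0.
Proof.
rewrite lp_norm.unlock; case: p => [r| |] //=; last first.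
  by move=> _; elim/big_ind: _ => [//|a b -> ->|i _]; rewrite ?maxxx// mxE normr0.
rewrite lee_fin => r1; have r0 : 0 < r by exact: lt_le_trans r1.
rewrite big1 ?powR0 ?invr_eq0 ?gt_eqF// => i _.
by rewrite mxE normr0 powR0// gt_eqF.
Qed.

Lemma lp_norm_eq0 p x : (1 <= p)%E -> lp_norm p x = 0 -> x = 0.
Proof.
rewrite lp_norm.unlock; case: p => [r| |] //=.
  rewrite lee_fin => r1 /powR_eq0_eq0 /eqP.
  rewrite psumr_eq0 => [/allP x0|i _]; last exact: powR_ge0.
  apply/rowP => i; rewrite mxE; apply/eqP; rewrite -normr_eq0.
  by apply/eqP/(@powR_eq0_eq0 _ _ r)/eqP; exact: x0 (mem_index_enum i).
move=> _ x0; apply/rowP => i; rewrite mxE; apply/eqP.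
by rewrite -normr_le0 -x0; apply: (@le_bigmax _ _ _ 0 (fun i => `|x 0 i|) i).
Qed.

Lemma lp_normN p x : lp_norm p (- x) = lp_norm p x.
Proof.
have xN i : `|(- x) 0 i| = `|x 0 i| by rewrite mxE normrN.
by case: p => [r| |]; rewrite lp_norm.unlock; try under eq_bigr do rewrite xN.
Qed.

Let convR r (a b t : R) : 1 <= r -> 0 <= a -> 0 <= b -> 0 <= t <= 1 ->
  (t * a + (1 - t) * b) `^ r <= t * a `^ r + (1 - t) * b `^ r.
Proof.
move=> r1 a0 b0 /andP[t0 t1].
have := @convex_powR R r r1 (Itv01 t0 t1) a b; rewrite !convRE/=.
by apply; rewrite inE/= in_itv/= ?a0 ?b0.
Qed.

Lemma lp_normD p x y :
  (1 <= p)%E -> lp_norm p (x + y) <= lp_norm p x + lp_norm p y.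
Proof.
move=> p1.
have [/(lp_norm_eq0 p1)->|x0] := eqVneq (lp_norm p x) 0.
  by rewrite lp_norm0// !add0r.
have [/(lp_norm_eq0 p1)->|y0] := eqVneq (lp_norm p y) 0.
  by rewrite lp_norm0// !addr0.
have A0 : 0 < lp_norm p x by rewrite lt_neqAle eq_sym x0 lp_norm_ge0.
have B0 : 0 < lp_norm p y by rewrite lt_neqAle eq_sym y0 lp_norm_ge0.
case: p p1 A0 B0 {x0 y0} => [r| |] // p1 A0 B0; last first.
  move: (ltW A0) (ltW B0); rewrite lp_norm.unlock /= => x0 y0.
  apply: bigmax_le => [|i _]; first exact: addr_ge0.
  rewrite mxE (le_trans (ler_normD _ _))// lerD//.
    exact: (@le_bigmax _ _ _ 0 (fun i => `|x 0 i|) i).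
  exact: (@le_bigmax _ _ _ 0 (fun i => `|y 0 i|) i).
have r1 : 1 <= r by rewrite -lee_fin.
have r0 : 0 < r by exact: lt_le_trans r1.
have normE (z : 'rV[R]_n) : \sum_(i < n) `|z 0 i| `^ r = lp_norm r%:E z `^ r.
  rewrite lp_norm.unlock /= -powRrM mulVf ?gt_eqF// powRr1//.
  by apply: sumr_ge0 => i _; exact: powR_ge0.
move: (normE x) (normE y) A0 B0.
set A := lp_norm _ x; set B := lp_norm _ y => SA SB A0 B0.
have AB0 : 0 < A + B by exact: addr_gt0.
pose t := A / (A + B).
have t1E : 1 - t = B / (A + B) by rewrite -(divff (lt0r_neq0 AB0)) -mulrBl addrC addKr.
have t01 : 0 <= t <= 1.
  by rewrite divr_ge0 ?(ltW A0) ?(ltW AB0)//= ler_pdivrMr// mul1r lerDl ltW.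
suff S : \sum_(i < n) `|(x + y) 0 i| `^ r <= (A + B) `^ r.
  have -> : A + B = ((A + B) `^ r) `^ r^-1.
    by rewrite -powRrM divff ?gt_eqF// powRr1// ltW.
  rewrite lp_norm.unlock /= ge0_ler_powR ?invr_ge0 ?(ltW r0) ?nnegrE ?powR_ge0//.
  by apply: sumr_ge0 => i _; exact: powR_ge0.
pose c (N a : R) := (a / N) `^ r.
have sumc (N : R) (z : 'rV[R]_n) : 0 < N -> \sum_(i < n) `|z 0 i| `^ r = N `^ r ->
    \sum_(i < n) c N `|z 0 i| = 1.
  move=> N0 SN.
  under eq_bigr do rewrite /c powRM ?invr_ge0 ?(ltW N0)//.
  rewrite -mulr_suml SN -powRM ?invr_ge0 ?(ltW N0)//.
  by rewrite divff ?gt_eqF// powR1.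
apply: (@le_trans _ _ (\sum_(i < n)
    (A + B) `^ r * (t * c A `|x 0 i| + (1 - t) * c B `|y 0 i|))).
  apply: ler_sum => i _.
  have cv : (t * (`|x 0 i| / A) + (1 - t) * (`|y 0 i| / B)) `^ r <=
      t * c A `|x 0 i| + (1 - t) * c B `|y 0 i|.
    by apply: convR => //; rewrite divr_ge0// ltW.
  apply: le_trans (ler_wpM2l (powR_ge0 _ _) cv).
  have cv0 : 0 <= t * (`|x 0 i| / A) + (1 - t) * (`|y 0 i| / B).
    by case/andP: t01 => ? ?; rewrite addr_ge0// mulr_ge0// ?subr_ge0// divr_ge0// ltW.
  rewrite -powRM// ?(ltW AB0)// ge0_ler_powR ?(ltW r0) ?nnegrE//.
    by rewrite mulr_ge0// ltW.
  have -> : (A + B) * (t * (`|x 0 i| / A) + (1 - t) * (`|y 0 i| / B)) =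
      `|x 0 i| + `|y 0 i|.
    rewrite t1E /t mulrDr; congr (_ + _).
      by rewrite mulrA [(A + B) * _]mulrC divfK ?gt_eqF// mulrC divfK ?gt_eqF.
    by rewrite mulrA [(A + B) * _]mulrC divfK ?gt_eqF// mulrC divfK ?gt_eqF.
  by rewrite mxE ler_normD.
rewrite -mulr_sumr big_split/= -!mulr_sumr !sumc//.
by rewrite !mulr1 addrC subrK mulr1.
Qed.

End lp_norm.

(* R^n with the metric of the norm lp_norm p; the alias hides the sup-norm
   structure that the library puts on row vectors. *)
Definition lp {R : realType} {p : \bar R} (p1 : (1 <= p)%E) (n : nat) : Type :=
  'rV[R]_n.

Section lp_metric.
Context {R : realType} {p : \bar R} (p1 : (1 <= p)%E) (n : nat).

HB.instance Definition _ := Choice.on (lp p1 n).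

Definition lp_dist (x y : lp p1 n) : R := lp_norm p ((x : 'rV[R]_n) - y).

Let lp_distxx x : lp_dist x x = 0.
Proof. by rewrite /lp_dist subrr lp_norm0. Qed.

Let lp_dist_positivity x y : lp_dist x y = 0 -> x = y.
Proof. by move/(lp_norm_eq0 p1)/eqP; rewrite subr_eq0 => /eqP. Qed.

Let lp_dist_sym x y : lp_dist x y = lp_dist y x.
Proof. by rewrite /lp_dist -lp_normN opprB. Qed.

Let lp_dist_triangle y x z : lp_dist x z <= lp_dist x y + lp_dist y z.
Proof. by rewrite /lp_dist -(subrKA y) lp_normD. Qed.

HB.instance Definition _ := @isMetric.Build R (lp p1 n) lp_dist
  lp_distxx lp_dist_positivity lp_dist_sym lp_dist_triangle.

End lp_metric.

(* Main.v *)
Require Import Defs.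
From mathcomp Require Import all_boot all_order all_algebra.
From mathcomp Require Import all_classical all_reals all_analysis.
From mathcomp Require Import ring lra zify.

Set Implicit Arguments.
Unset Strict Implicit.
Unset Printing Implicit Defensive.

Import Order.TTheory GRing.Theory Num.Theory.
Import numFieldNormedType.Exports.

Local Open Scope classical_set_scope.
Local Open Scope ring_scope.

(** Why the bound holds.  Let q = 1/p and kappa = n^max(1/2, q).

    At every scale s > 0 the space l_p^n carries Lipschitz weights on a lattice.
    Put h = s n^(-q) and, for x in R^n and a lattice index j, let w(x, j) be the
    product over the coordinates i of psi(x_i / h - j_i)^2, where psi is an even
    bump on [-1, 1] that follows a quarter of a cosine wave.  As
    cos^2 + sin^2 = 1, the weights w(x, .) form a product probability measure; it
    lives on the corners of a cell of side h, and these are within s of x in the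
    l_p norm.  The total variation distance of two product measures is at most
    twice their Hellinger distance, and squared Hellinger distances add up over
    the factors.  Since psi is Lipschitz, w(x, .) and w(x', .) therefore differ in
    l_1 by O(|x - x'|_2 / h) = O(n^q |x - x'|_2 / s), which is
    O(kappa |x - x'|_p / s): for p <= 2 because |.|_2 <= |.|_p, for p >= 2 by the
    power mean inequality.  Estimating the measures coordinate by coordinate in
    l_1 instead would give |x - x'|_1 in place of |x - x'|_2, and only the bound
    O(n) for p = oo.  This is [lp_fuzzy_cover]; its core is
    [product_l1_le_hellinger].

    In any metric space such weights give extensions with constant O(kappa), as in
    the classical extension procedure of Whitney.  Extend f to the closure of the
    set A by completeness ([lipschitz_closure]).  At a fixed scale s, average over
    w(x, .) the values of f at points of A that are almost nearest to the nodes: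
    near points x whose distance to A is comparable to s, this average moves with
    x at the rate O(kappa) times the Lipschitz constant of f ([fuzzy_average]).
    Finally let the scale be the distance of x to A, by interpolating linearly
    between the averages at the two neighbouring dyadic scales; the interpolation
    costs only a bounded factor ([dyadic_interp_lipschitz]).  The result is
    [lipschitz_extension_modulus_le].

    All sums are finite, so nothing has to be integrated in the target space. *)

(** * Distance to a set, and extension to its closure *)

Section metric.
Context {R : realType} {M : metricType R}.
Implicit Types x y z : M.

Lemma mdist_sym x y : mdist x y = mdist y x.
Proof. exact: metric_sym. Qed.

Lemma mdist_triangle x y z : mdist x z <= mdist x y + mdist y z :> R.
Proof. exact: metric_triangle. Qed.

End metric.

Section distance_to_set.
Context {R : realType} {M : metricType R}.
Implicit Types (A : set M) (x y a : M).

Definition set_dist A x : R := inf [set mdist x a | a in A].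

Let dists_lb A x : lbound [set mdist x a | a in A] 0.
Proof. by move=> _ [a _ <-]; exact: mdist_ge0. Qed.

Lemma set_dist_ge0 A x : A !=set0 -> 0 <= set_dist A x.
Proof.
by move=> [a Aa]; apply: lb_le_inf; [exists (mdist x a), a|exact: dists_lb].
Qed.

Lemma set_dist_le A x a : A a -> set_dist A x <= mdist x a :> R.
Proof.
by move=> Aa; apply: ge_inf; [exists 0; exact: dists_lb|exists a].
Qed.

Lemma set_dist_near A x (e : R) : A !=set0 -> 0 < e ->
  exists2 a, A a & mdist x a < set_dist A x + e :> R.
Proof.
move=> [a Aa] e0.
have [|_ [b Ab <-] be] := @inf_adherent _ [set mdist x a | a in A] _ e0.
  by split; [exists (mdist x a), a|exists 0; exact: dists_lb].
by exists b.
Qed.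

Lemma set_dist_triangle A x y : A !=set0 ->
  set_dist A x <= mdist x y + set_dist A y :> R.
Proof.
move=> A0; apply/ler_addgt0Pr => e e0.
have [a Aa ya] := set_dist_near y A0 e0.
have := set_dist_le x Aa; have := mdist_triangle x y a; lra.
Qed.

Lemma set_dist_eq0 A x : A x -> set_dist A x = 0.
Proof.
move=> Ax; apply/eqP; rewrite eq_le set_dist_ge0 ?andbT; last by exists x.
by rewrite -[leRHS](mdistxx x) set_dist_le.
Qed.

End distance_to_set.

Section closure.
Context {R : realType} {M : metricType R} {Z : completeNormedModType R}.

(** The values of [f] along a sequence of [A] that converges to [x] form a Cauchy
    sequence. *)
Lemma lipschitz_adherent_point (A : set M) (f : M -> Z) (k : R) (x : M) :
  0 <= k -> A !=set0 -> lipschitz_with k A f -> set_dist A x = 0 ->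
  exists l, forall a, A a -> `|l - f a| <= k * mdist x a.
Proof.
move=> k0 A0 fk x0.
have /choice[u uP] (n : nat) : exists a, A a /\ mdist x a < harmonic n :> R.
  have [a Aa] := @set_dist_near R M A x (harmonic n) A0 (harmonic_gt0 n).
  by rewrite x0 add0r => xa; exists a.
have fuP n a : A a -> `|f (u n) - f a| <= k * (harmonic n + mdist x a).
  move=> Aa; have [Aun xun] := uP n.
  apply: le_trans (fk _ _ Aun Aa) _; apply: ler_wpM2l => //.
  have := mdist_triangle (u n) x a; rewrite (mdist_sym (u n) x); lra.
have small (e : R) : 0 < e -> \forall n \near \oo, k * harmonic n < e.
  move=> e0.
  have ek : 0 < e / (k + 1) by rewrite divr_gt0// ltr_wpDl.
  near=> n.
  have : @harmonic R n < e / (k + 1).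
    by near: n; exact: (near_infty_natSinv_lt (PosNum ek)).
  rewrite ltr_pdivlMr ?ltr_wpDl// mulrDr mulr1 mulrC => h.
  by apply: le_lt_trans h; rewrite lerDl harmonic_ge0.
have fucvg : cvg (f \o u @ \oo).
  apply/cauchy_cvgP; apply: cauchy_exP => e e0.
  have e20 : 0 < e / 2 by rewrite divr_gt0.
  have [N _ Ne] := small _ e20.
  exists (f (u N)); exists N => // m /= Nm.
  rewrite -ball_normE /=; apply: le_lt_trans (fuP N (u m) (uP m).1) _.
  have h2 : k * harmonic m < e / 2 := Ne m Nm.
  have h3 : k * harmonic N < e / 2 := Ne N (leqnn N).
  have : k * mdist x (u m) <= k * harmonic m by rewrite ler_wpM2l// ltW// (uP m).2.
  rewrite mulrDr; lra.
exists (lim (f \o u @ \oo)) => a Aa.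
apply/ler_addgt0Pr => e e0.
have e20 : 0 < e / 2 by rewrite divr_gt0.
near \oo => n.
have h1 : `|lim (f \o u @ \oo) - f (u n)| < e / 2 :> R.
  near: n.
  by move/cvgrPdist_lt : fucvg => /(_ _ e20).
have h2 : k * harmonic n < e / 2 by near: n; exact: small.
have := fuP n a Aa; rewrite mulrDr => h3.
have := ler_distD (f (u n)) (lim (f \o u @ \oo)) (f a); lra.
Unshelve. all: by end_near. Qed.

(** Two limit values are compared through a single point of [A] close to one of
    the two points, so the constant does not grow. *)
Lemma lipschitz_closure (A : set M) (f : M -> Z) (k : R) :
  0 <= k -> A !=set0 -> lipschitz_with k A f ->
  exists g : M -> Z, (forall x, A x -> g x = f x) /\
    lipschitz_with k [set x | set_dist A x = 0] g.
Proof.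
move=> k0 A0 fk.
have /choice[g gP] (x : M) : exists l,
    set_dist A x = 0 -> forall a, A a -> `|l - f a| <= k * mdist x a.
  have [x0|] := pselect (set_dist A x = 0); last by exists 0.
  by have [l lP] := lipschitz_adherent_point k0 A0 fk x0; exists l.
exists g; split => [x Ax|x y /= x0 y0].
  have := gP x (set_dist_eq0 Ax) x Ax.
  by rewrite mdistxx mulr0 normr_le0 subr_eq0 => /eqP.
apply/ler_addgt0Pr => e e0.
have ek : 0 < e / (2 * (k + 1)) by rewrite divr_gt0// mulr_gt0// ltr_wpDl.
have [a Aa] := set_dist_near x A0 ek; rewrite x0 add0r => xa.
have h1 := gP x x0 a Aa; have h2 := gP y y0 a Aa.
have h3 : k * mdist y a <= k * (mdist x y + mdist x a).
  by rewrite ler_wpM2l// (le_trans (mdist_triangle y x a))// (mdist_sym y).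
have h4 : 2 * (k * mdist x a) <= e.
  move: xa; rewrite ltr_pdivlMr ?mulr_gt0 ?ltr_wpDl// => xa.
  have := mdist_ge0 x a; nra.
have := ler_distD (f a) (g x) (g y); rewrite (distrC (f a)); lra.
Qed.

End closure.

(** * Averaging at one scale *)

Section averages.
Context {R : realType} {M : metricType R} {J : choiceType}.

(** A partition of unity at scale [s] whose l_1 modulus of continuity is [K / s]:
    equivalently, a randomly chosen node [y j] within [s] of [x], whose law moves
    in total variation at the rate [K / s].  The index set may be infinite; each
    pair of points sees only the finite part [D] of it. *)
Definition fuzzy_cover (K s : R) (y : J -> M) (w : M -> J -> R) : Prop :=
  [/\ forall x j, 0 <= w x j,
      forall x j, w x j != 0 -> mdist x (y j) <= s :> R &
      forall x x', exists D : seq J,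
        [/\ uniq D, forall j, j \notin D -> w x j = 0 /\ w x' j = 0,
            \sum_(j <- D) w x j = 1, \sum_(j <- D) w x' j = 1 &
            s * (\sum_(j <- D) `|w x j - w x' j|) <= K * mdist x x']].

(** The average of [f (g j)] with weights [w x j], where [g j] is a point of [A]
    almost nearest to the node [y j].  If [y j] is within [s] of [x], then [g j] is
    within [3 s + 2 d(x, c)] of any [c] in [A]: this is the first bound.  In
    [a x - a x'] the value [f c] can be subtracted from all values of [f], because
    both families of weights have total mass 1; what remains is the l_1 variation
    of the weights times the first bound. *)
Lemma fuzzy_average (Z : normedModType R) (A : set M) (f : M -> Z)
    (k K s : R) (y : J -> M) (w : M -> J -> R) :
  A !=set0 -> 0 <= k -> lipschitz_with k A f -> 0 < s -> fuzzy_cover K s y w ->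
  exists a : M -> Z,
    (forall x c, A c -> `|a x - f c| <= k * (3 * s + 2 * mdist x c)) /\
    (forall x x' c r, A c -> mdist x c <= r :> R -> mdist x' c <= r :> R ->
      s * `|a x - a x'| <= K * mdist x x' * (k * (3 * s + 2 * r))).
Proof.
move=> A0 k0 fk s0 [w0 ws wD].
have /choice[g gP] (j : J) : exists b, A b /\
    mdist (y j) b <= set_dist A (y j) + s :> R.
  by have [b Ab /ltW yb] := set_dist_near (y j) A0 s0; exists b.
have fg x j c : A c -> w x j != 0 ->
    `|f (g j) - f c| <= k * (3 * s + 2 * mdist x c).
  move=> Ac /ws xy; have [Agj yg] := gP j.
  apply: le_trans (fk _ _ Agj Ac) _; rewrite ler_wpM2l//.
  have := mdist_triangle (g j) (y j) c; rewrite (mdist_sym (g j) (y j)).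
  have := mdist_triangle (y j) x c; rewrite (mdist_sym (y j) x).
  have := set_dist_le (y j) Ac; lra.
pose a x := \sum_(j \in [set: J]) w x j *: f (g j).
have aE x (D : seq J) : uniq D -> (forall j, j \notin D -> w x j = 0) ->
    a x = \sum_(j <- D) w x j *: f (g j).
  move=> uD xD; rewrite fsbig_seq// /a; apply/esym/fsbig_widen => // j /= [_ jD].
  by rewrite xD ?scale0r//; apply/negP.
exists a; split.
- move=> x c Ac; have [D [uD xD x1 _ _]] := wD x x.
  have -> : a x - f c = \sum_(j <- D) w x j *: (f (g j) - f c).
    rewrite (aE x D)// => [|j /xD[]//].
    by under [RHS]eq_bigr do rewrite scalerBr; rewrite sumrB -scaler_suml x1 scale1r.
  apply: le_trans (ler_norm_sum _ _ _) _.
  rewrite -[leRHS]mul1r -[X in _ <= X * _]x1 mulr_suml; apply: ler_sum => j _.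
  rewrite normrZ ger0_norm//; have [->|wj] := eqVneq (w x j) 0.
    by rewrite !mul0r.
  by apply: ler_wpM2l => //; exact: fg.
- move=> x x' c r Ac xr x'r; have [D [uD xD x1 x'1 var]] := wD x x'.
  have -> : a x - a x' = \sum_(j <- D) (w x j - w x' j) *: (f (g j) - f c).
    rewrite (aE x D)// => [|j /xD[]//]; rewrite (aE x' D)// => [|j /xD[]//].
    under [RHS]eq_bigr do rewrite scalerBr.
    rewrite [RHS]sumrB -scaler_suml sumrB x1 x'1 subrr scale0r subr0.
    by under [RHS]eq_bigr do rewrite scalerBl; rewrite sumrB.
  have B0 : 0 <= k * (3 * s + 2 * r).
    by rewrite mulr_ge0//; have := mdist_ge0 x c; lra.
  apply: (@le_trans _ _
    (s * (\sum_(j <- D) `|w x j - w x' j|) * (k * (3 * s + 2 * r)))).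
    rewrite -mulrA ler_wpM2l ?(ltW s0)// mulr_suml.
    apply: le_trans (ler_norm_sum _ _ _) _; apply: ler_sum => j _.
    rewrite normrZ.
    have [wj|wj] := eqVneq (w x j) 0; have [wj'|wj'] := eqVneq (w x' j) 0.
    + by rewrite wj wj' subrr normr0 !mul0r.
    + rewrite ler_wpM2l// (le_trans (fg x' j c Ac wj'))// ler_wpM2l//; lra.
    + rewrite ler_wpM2l// (le_trans (fg x j c Ac wj))// ler_wpM2l//; lra.
    + rewrite ler_wpM2l// (le_trans (fg x j c Ac wj))// ler_wpM2l//; lra.
  by rewrite ler_wpM2r.
Qed.

End averages.

(** * Interpolation between dyadic scales *)

Section dyadic_interpolation.
Context {R : realType}.

Let ln2_gt0 : 0 < ln 2 :> R.
Proof. by rewrite ln_gt0// ltr1n. Qed.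

(** The largest integral power of 2 that is at most [r], for [r > 0]. *)
Definition dyadic (r : R) : R := expR ((Num.floor (ln r / ln 2))%:~R * ln 2).

Lemma dyadic_gt0 r : 0 < dyadic r.
Proof. exact: expR_gt0. Qed.

Lemma dyadic_itv r : 0 < r -> dyadic r <= r < 2 * dyadic r.
Proof.
move=> r0; have rE : r = expR (ln r / ln 2 * ln 2) by rewrite divfK ?gt_eqF ?lnK.
apply/andP; split; first by rewrite {2}rE /dyadic ler_expR ler_pM2r// floor_le.
have -> : 2 * dyadic r = expR ((Num.floor (ln r / ln 2) + 1)%:~R * ln 2).
  by rewrite intrD [in RHS]mulrDl mul1r expRD lnK ?posrE// [in RHS]mulrC.
by rewrite {1}rE ltr_expR ltr_pM2r// floorD1_gt.
Qed.

Lemma dyadic_adjacent r r' : 0 < r' -> r' <= r -> r <= 2 * r' ->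
  dyadic r = dyadic r' \/ dyadic r = 2 * dyadic r'.
Proof.
move=> r'0 r'r r2r'.
have r0 : 0 < r by exact: lt_le_trans r'r.
have l1 : (Num.floor (ln r' / ln 2) <= Num.floor (ln r / ln 2))%R.
  by apply: le_floor; rewrite ler_pM2r ?invr_gt0// ler_ln.
have l2 : (Num.floor (ln r / ln 2) <= Num.floor (ln r' / ln 2) + 1)%R.
  rewrite -ltzD1 -(ltr_int R) intrD; apply: le_lt_trans (floor_le _) _.
  apply: (@le_lt_trans _ _ (ln r' / ln 2 + 1)); last by rewrite ltrD2r floorD1_gt.
  rewrite ler_pdivrMr// mulrDl divfK ?gt_eqF// mul1r addrC -lnM ?posrE//.
  by rewrite ler_ln ?posrE// mulr_gt0.
rewrite /dyadic; move: l1 l2.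
set m := Num.floor (ln r / ln 2); set m' := Num.floor (ln r' / ln 2) => l1 l2.
have [->|mm'] := eqVneq m m'; first by left.
right; have -> : m = m' + 1 by lia.
by rewrite intrD [in LHS]mulrDl mul1r expRD lnK ?posrE// [in LHS]mulrC.
Qed.

Context {Z : normedModType R}.
Implicit Types a b : R -> Z.

Definition dyadic_interp a r : Z :=
  let s := dyadic r in a s + (r / s - 1) *: (a (2 * s) - a s).

(** The interpolated value is a convex combination of the values at the two
    neighbouring scales. *)
Lemma dyadic_interp_sub a b r (B : R) : 0 < r ->
  `|a (dyadic r) - b (dyadic r)| <= B ->
  `|a (2 * dyadic r) - b (2 * dyadic r)| <= B ->
  `|dyadic_interp a r - dyadic_interp b r| <= B.
Proof.
move=> r0; rewrite /dyadic_interp.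
have /andP[] := dyadic_itv r0; have := dyadic_gt0 r.
set s := dyadic r => s0 sr r2s h1 h2.
have t0 : 0 <= r / s - 1 by rewrite subr_ge0 ler_pdivlMr// mul1r.
have t1 : r / s - 1 <= 1 by rewrite lerBlDr ler_pdivrMr// ltW.
move: (r / s - 1) t0 t1 => t t0 t1.
have -> : a s + t *: (a (2 * s) - a s) - (b s + t *: (b (2 * s) - b s)) =
    (1 - t) *: (a s - b s) + t *: (a (2 * s) - b (2 * s)).
  rewrite scalerBl scale1r opprD addrACA -[RHS]addrA; congr (_ + _).
  by rewrite [RHS]addrC -!scalerBr !opprD addrACA.
apply: le_trans (ler_normD _ _) _; rewrite !normrZ !ger0_norm ?subr_ge0//.
have : (1 - t) * `|a s - b s| <= (1 - t) * B by rewrite ler_wpM2l// subr_ge0.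
have : t * `|a (2 * s) - b (2 * s)| <= t * B by rewrite ler_wpM2l.
lra.
Qed.

Lemma dyadic_interp_cst (z : Z) r : dyadic_interp (fun=> z) r = z.
Proof. by rewrite /dyadic_interp subrr scaler0 addr0. Qed.

(** In its second argument the interpolation is continuous and piecewise affine,
    with slope at most [B / dyadic r'] on the one or two pieces between [r'] and
    [r]. *)
Lemma dyadic_interp_lipschitz a r r' (B : R) : 0 < r' -> r' <= r -> r <= 2 * r' ->
  `|a (2 * dyadic r) - a (dyadic r)| <= B ->
  `|a (2 * dyadic r') - a (dyadic r')| <= B ->
  dyadic r' * `|dyadic_interp a r - dyadic_interp a r'| <= B * (r - r').
Proof.
move=> r'0 r'r r2r' h h'.
have r0 : 0 < r by exact: lt_le_trans r'r.
have [/andP[sr rs] /andP[sr' rs']] := (dyadic_itv r0, dyadic_itv r'0).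
have s'0 := dyadic_gt0 r'.
have B0 : 0 <= B by exact: le_trans h.
rewrite /dyadic_interp; case: (dyadic_adjacent r'0 r'r r2r') => sE.
- rewrite sE opprD addrACA subrr add0r -scalerBl normrZ.
  rewrite (_ : r / _ - 1 - _ = (r - r') / dyadic r'); last by field; rewrite gt_eqF.
  rewrite ger0_norm ?divr_ge0 ?subr_ge0 ?(ltW s'0)//.
  rewrite mulrA mulrCA divff ?gt_eqF// mulr1 mulrC.
  by rewrite ler_wpM2r ?subr_ge0.
(* the pieces meet at [2 * dyadic r'], where the interpolation takes the value of
   [a] itself; both increments are measured from there *)
- move: h sr rs; rewrite sE; set s := dyadic r' => h sr rs.
  set d := _ - a (2 * s); set d' := a (2 * s) - a s.
  have -> : a (2 * s) + (r / (2 * s) - 1) *: d - (a s + (r' / s - 1) *: d') =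
      (r / (2 * s) - 1) *: d + (2 - r' / s) *: d'.
    rewrite (_ : 2 - r' / s = 1 - (r' / s - 1)); last by lra.
    by rewrite (scalerBl 1) scale1r opprD addrACA [RHS]addrCA.
  have e1 : 0 <= r / (2 * s) - 1.
    by rewrite subr_ge0 ler_pdivlMr ?mulr_gt0// mul1r.
  have e2 : 0 <= 2 - r' / s by rewrite subr_ge0 ler_pdivrMr// ltW.
  have := ler_normD ((r / (2 * s) - 1) *: d) ((2 - r' / s) *: d').
  rewrite !normrZ !ger0_norm// => hD.
  have h1 : (r / (2 * s) - 1) * `|d| <= (r / (2 * s) - 1) * B by rewrite ler_wpM2l.
  have h2 : (2 - r' / s) * `|d'| <= (2 - r' / s) * B by rewrite ler_wpM2l.
  have h3 : s * ((r / (2 * s) - 1) * B + (2 - r' / s) * B) =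
      B * (r / 2 - s + 2 * s - r').
    by field; rewrite gt_eqF.
  apply: (@le_trans _ _ (s * ((r / (2 * s) - 1) * B + (2 - r' / s) * B))).
    by rewrite ler_wpM2l ?(ltW s'0)//; lra.
  rewrite h3 ler_wpM2l//; lra.
Qed.

End dyadic_interpolation.

(** * From weights at all scales to extensions *)

Section extension.
Context {R : realType} {M : metricType R}.

(** The extension at [x] interpolates the averages of [fuzzy_average] at the
    scale [rho x], the distance of [x] to [A].  If [x] and [y] are at distance
    at least half of [rho x] (the larger of [rho x] and [rho y]), comparison with
    [f] at one point of [A] suffices.  Otherwise the passage from [x] to [y] is split
    in two: at the fixed scale [rho x] the point moves, which costs
    [13 K k d(x, y)]; then at the fixed point [y] the scale moves from [rho x] to
    [rho y], which costs [76 k d(x, y)], because [rho] is 1-Lipschitz and averages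
    at neighbouring scales differ by at most [19 k rho x]. *)
Lemma lipschitz_extension_closed (Z : normedModType R) (K k : R) (A : set M)
    (f : M -> Z) :
  1 <= K ->
  (forall s : R, 0 < s -> exists (J : choiceType) (y : J -> M) (w : M -> J -> R),
    fuzzy_cover K s y w) ->
  0 <= k -> A !=set0 -> (forall x, set_dist A x = 0 -> A x) ->
  lipschitz_with k A f ->
  exists F : M -> Z, (forall x, A x -> F x = f x) /\
    lipschitz_with (100 * K * k) setT F.
Proof.
move=> K1 cover k0 A0 Acl fk.
have /choice[a aP] (s : R) : exists a : M -> Z, 0 < s ->
    (forall x c, A c -> `|a x - f c| <= k * (3 * s + 2 * mdist x c)) /\
    (forall x x' c r, A c -> mdist x c <= r :> R -> mdist x' c <= r :> R ->
      s * `|a x - a x'| <= K * mdist x x' * (k * (3 * s + 2 * r))).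
  have [s0|_] := ltP 0 s; last by exists (fun=> 0).
  have [J [y [w yw]]] := cover s s0.
  by have [a aP] := fuzzy_average A0 k0 fk s0 yw; exists a.
pose rho := set_dist A.
pose F x := if rho x == 0 then f x else dyadic_interp (a^~ x) (rho x).
have FA x : A x -> F x = f x by move=> Ax; rewrite /F /rho set_dist_eq0 ?eqxx.
have Fint x : 0 < rho x -> F x = dyadic_interp (a^~ x) (rho x).
  by move=> x0; rewrite /F gt_eqF.
(* both scales used at [x] are at most [2 * rho x] *)
have Fc x c : 0 < rho x -> A c ->
    `|F x - f c| <= k * (6 * rho x + 2 * mdist x c).
  move=> x0 Ac; rewrite Fint// -{1}(dyadic_interp_cst (f c) (rho x)).
  have /andP[sx xs] := dyadic_itv x0; have s0 := dyadic_gt0 (rho x).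
  apply: dyadic_interp_sub => //.
    by apply: le_trans ((aP _ s0).1 x c Ac) _; rewrite ler_wpM2l//; lra.
  have s20 : 0 < 2 * dyadic (rho x) by rewrite mulr_gt0.
  by apply: le_trans ((aP _ s20).1 x c Ac) _; rewrite ler_wpM2l//; lra.
exists F; split=> //.
suff Flip x y : rho y <= rho x -> `|F x - F y| <= 100 * K * k * mdist x y.
  move=> x y _ _; have [xy|/ltW xy] := leP (rho y) (rho x); first exact: Flip.
  by rewrite distrC (mdist_sym x); exact: Flip.
move=> yx; have d0 : 0 <= mdist x y :> R by exact: mdist_ge0.
set d : R := mdist x y in d0 *.
have kK : k <= K * k by rewrite ler_peMl.
have kdK : k * d <= K * k * d by rewrite ler_wpM2r.
have [x0|xN0] := eqVneq (rho x) 0.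
  have y0 : rho y = 0 by apply/eqP; rewrite eq_le set_dist_ge0// -{1}x0 yx.
  rewrite !FA; [|exact: Acl|exact: Acl].
  apply: le_trans (fk _ _ (Acl _ x0) (Acl _ y0)) _; rewrite -/d.
  have : 0 <= K * k * d by apply: le_trans kdK; exact: mulr_ge0.
  lra.
have {xN0} x0 : 0 < rho x by rewrite lt_neqAle eq_sym xN0 set_dist_ge0.
have [y0|yN0] := eqVneq (rho y) 0.
  have Ay := Acl _ y0; rewrite (FA y)//.
  apply: le_trans (Fc x y x0 Ay) _; rewrite -/d.
  have : rho x <= d by exact: set_dist_le.
  move/(ler_wpM2l k0); have : 0 <= k * d by exact: mulr_ge0.
  rewrite mulrDr; lra.
have {yN0} y0 : 0 < rho y by rewrite lt_neqAle eq_sym yN0 set_dist_ge0.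
have xyd : rho x <= d + rho y by exact: set_dist_triangle.
(* [c] is within [2 * rho x] of [x] *)
have [c Ac xc] := set_dist_near x A0 x0.
have yc : mdist y c <= d + mdist x c :> R.
  by rewrite /d (mdist_sym x y) mdist_triangle.
have [far|near] := leP (rho x) (2 * d).
  have h1 := Fc x c x0 Ac; have h2 := Fc y c y0 Ac.
  have h3 := ler_distD (f c) (F x) (F y); rewrite (distrC (f c)) in h3.
  have h4 : k * (6 * rho x + 2 * mdist x c) + k * (6 * rho y + 2 * mdist y c) <=
      k * (42 * d).
    by rewrite -mulrDr ler_wpM2l//; rewrite /rho in xc h1 yx far *; lra.
  have : 0 <= k * d by exact: mulr_ge0.
  lra.
have yx2 : rho x <= 2 * rho y by lra.
have [/andP[sx xs] /andP[sy ys]] := (dyadic_itv x0, dyadic_itv y0).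
have [sx0 sy0] := (dyadic_gt0 (rho x), dyadic_gt0 (rho y)).
have xcr : mdist x c <= 5 / 2 * rho x :> R by rewrite /rho in xc *; lra.
have ycr : mdist y c <= 5 / 2 * rho x :> R by rewrite /rho in xc near *; lra.
have Kkd0 : 0 <= K * k * d by apply: le_trans kdK; exact: mulr_ge0.
have hxy s : dyadic (rho x) <= s -> `|a s x - a s y| <= 13 * (K * k * d).
  move=> xsx; have s0 : 0 < s by exact: lt_le_trans xsx.
  rewrite -(ler_pM2l s0); apply: le_trans ((aP _ s0).2 x y c _ Ac xcr ycr) _.
  have -> : s * (13 * (K * k * d)) = K * k * d * (13 * s) by ring.
  rewrite -/d (_ : K * d * _ = K * k * d * (3 * s + 2 * (5 / 2 * rho x))); last by ring.
  by rewrite ler_wpM2l//; lra.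
have hs s : 0 < s -> s <= rho x -> `|a (2 * s) y - a s y| <= 19 * k * rho x.
  move=> s0 sr; have s20 : 0 < 2 * s by rewrite mulr_gt0.
  have h1 := (aP _ s0).1 y c Ac; have h2 := (aP _ s20).1 y c Ac.
  have h3 := ler_distD (f c) (a (2 * s) y) (a s y).
  rewrite (distrC (f c)) in h3.
  have h4 : k * (3 * (2 * s) + 2 * mdist y c) + k * (3 * s + 2 * mdist y c) <=
      k * (19 * rho x).
    by rewrite -mulrDr ler_wpM2l//; lra.
  lra.
have e1 : `|F x - dyadic_interp (a^~ y) (rho x)| <= 13 * (K * k * d).
  rewrite Fint//; apply: dyadic_interp_sub => //; apply: hxy; lra.
have e2 : `|dyadic_interp (a^~ y) (rho x) - F y| <= 76 * (k * d).
  have := @dyadic_interp_lipschitz _ _ (a^~ y) _ _ _ y0 yx yx2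
    (hs _ sx0 sx) (hs _ sy0 (le_trans sy yx)).
  rewrite -Fint// => h; rewrite -(ler_pM2l sy0); apply: le_trans h _.
  have h1 : 19 * k * rho x * (rho x - rho y) <= 19 * k * rho x * d.
    by rewrite ler_wpM2l; [|rewrite !mulr_ge0// ltW|lra].
  have h2 : k * d * rho x <= k * d * (4 * dyadic (rho y)).
    by rewrite ler_wpM2l; [|exact: mulr_ge0|lra].
  by apply: le_trans h1 _; lra.
have := ler_distD (dyadic_interp (a^~ y) (rho x)) (F x) (F y); lra.
Qed.

Lemma lipschitz_constant_attained (Z : normedModType R) (A : set M) (f : M -> Z) :
  is_lipschitz A f ->
  exists k : R, [/\ 0 <= k, lipschitz_with k A f & lipschitz_constant A f = k%:E].
Proof.
move=> [k0 k00 fk0]; rewrite /lipschitz_constant.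
set S := [set K : R | 0 <= K /\ lipschitz_with K A f].
have Slb : lbound S 0 by move=> k [].
have S0 : S !=set0 by exists k0.
exists (inf S); split.
- exact: lb_le_inf.
- move=> x y Ax Ay; apply/ler_addgt0Pr => e e0.
  have d1 : 0 < mdist x y + 1 :> R by rewrite ltr_wpDl// mdist_ge0.
  have ed : 0 < e / (mdist x y + 1) by rewrite divr_gt0.
  have [k [k0' fk] ke] := inf_adherent ed (conj S0 (ex_intro _ 0 Slb)).
  apply: le_trans (fk _ _ Ax Ay) _.
  apply: (@le_trans _ _ ((inf S + e / (mdist x y + 1)) * mdist x y)).
    by rewrite ler_wpM2r ?mdist_ge0// ltW.
  rewrite mulrDl lerD2l -mulrA ler_piMr ?(ltW e0)// mulrC ler_pdivrMr// mul1r.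
  by rewrite lerDl.
- by rewrite ereal_inf_EFin//; exists 0.
Qed.

(** Extension to the closure keeps the constant, and the infimum that defines the
    Lipschitz constant of [f] is attained, so the factor [100 * K] applies to that
    constant itself. *)
Lemma lipschitz_extension_modulus_le (K : R) : 1 <= K ->
  (forall s : R, 0 < s -> exists (J : choiceType) (y : J -> M) (w : M -> J -> R),
    fuzzy_cover K s y w) ->
  (lipschitz_extension_modulus M <= (100 * K)%:E)%E.
Proof.
move=> K1 cover; apply: ereal_inf_lbound; split.
  by rewrite lee_fin; lra.
move=> A Z f A0 /lipschitz_constant_attained[k [k0 fk ->]].
have [g [gf gk]] := lipschitz_closure k0 A0 fk.
set B := [set x | set_dist A x = 0] in gk.
have AB : A `<=` B by move=> x; exact: set_dist_eq0.
have B0 : B !=set0 by case: A0 => x /AB; exists x.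
have Bcl x : set_dist B x = 0 -> B x.
  move=> x0; apply/eqP; rewrite eq_le set_dist_ge0// andbT.
  apply/ler_addgt0Pr => e e0; have [b Bb] := set_dist_near x B0 e0.
  rewrite x0 add0r => xb; have := set_dist_triangle x b A0.
  rewrite Bb; lra.
have [F [Fg Fk]] := lipschitz_extension_closed K1 cover k0 B0 Bcl gk.
exists F; split=> [x Ax|]; first by rewrite Fg ?gf//; exact: AB.
rewrite -EFinM; apply: ereal_inf_lbound; exists (100 * K * k) => //; split=> //.
by rewrite !mulr_ge0//; lra.
Qed.

End extension.

(** * Total variation of product measures *)

Section hellinger.
Context {R : realType}.

Lemma one_sub_prod_le (I : finType) (a : I -> R) :
  (forall i, 0 <= a i <= 1) -> 1 - \prod_i a i <= \sum_i (1 - a i).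
Proof.
move=> a01; suff : 0 <= \prod_i a i <= 1 /\ 1 - \prod_i a i <= \sum_i (1 - a i).
  by case.
elim/big_rec2: _ => [|i p s _ [/andP[p0 p1] IH]]; first by rewrite subrr ler01 lexx.
have /andP[a0 a1] := a01 i; split.
  by rewrite mulr_ge0//= mulr_ile1.
have : a i * (1 - s) <= 1 * (1 - s) by rewrite ler_wpM2r// subr_ge0.
nra.
Qed.

(** The families [u i] and [v i] are the square roots of the densities of two
    product probability measures, with square-root densities [U] and [V].  Their
    squared Hellinger distance is [2 (1 - <U, V>)], and [<U, V>] is the product
    of the [<u i, v i>]; hence it is at most the sum of the squared Hellinger
    distances of the factors, and so at most [B ^ 2].  Since
    [|U^2 - V^2| = |U - V| (U + V)] and the l_2 norm of [U + V] is at most 2, the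
    Cauchy-Schwarz inequality bounds the l_1 distance by [2 B]. *)
Lemma product_l1_le_hellinger (I T : finType) (u v : I -> T -> R) (B : R) :
  (forall i t, 0 <= u i t) -> (forall i t, 0 <= v i t) ->
  (forall i, \sum_t u i t ^+ 2 = 1) -> (forall i, \sum_t v i t ^+ 2 = 1) ->
  0 <= B -> \sum_i \sum_t (u i t - v i t) ^+ 2 <= B ^+ 2 ->
  \sum_(j : {ffun I -> T}) `|\prod_i u i (j i) ^+ 2 - \prod_i v i (j i) ^+ 2|
    <= 2 * B.
Proof.
move=> u0 v0 u1 v1 + uvB.
wlog B0 : B uvB / 0 < B => [hw B0|_].
  apply/ler_addgt0Pr => e e0; have e20 : 0 < e / 2 by rewrite divr_gt0.
  have -> : 2 * B + e = 2 * (B + e / 2) by field.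
  apply: hw; [|by rewrite ltr_wpDl|by rewrite addr_ge0// ltW].
  apply: le_trans uvB _; rewrite ler_pXn2r// ?nnegrE; lra.
pose U (j : {ffun I -> T}) := \prod_i u i (j i).
pose V (j : {ffun I -> T}) := \prod_i v i (j i).
have U0 j : 0 <= U j by apply: prodr_ge0.
have V0 j : 0 <= V j by apply: prodr_ge0.
have U1 : \sum_j U j ^+ 2 = 1.
  under eq_bigr do rewrite -prodrXl.
  rewrite -(bigA_distr_bigA (fun i t => u i t ^+ 2)).
  by rewrite big1.
have V1 : \sum_j V j ^+ 2 = 1.
  under eq_bigr do rewrite -prodrXl.
  rewrite -(bigA_distr_bigA (fun i t => v i t ^+ 2)).
  by rewrite big1.
have UV : \sum_j U j * V j = \prod_i \sum_t u i t * v i t.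
  rewrite bigA_distr_bigA; apply: eq_bigr => j _.
  by rewrite -big_split.
have sq (S : finType) (f g : S -> R) : \sum_s f s ^+ 2 = 1 ->
    \sum_s g s ^+ 2 = 1 ->
    \sum_s (f s - g s) ^+ 2 = 2 * (1 - \sum_s f s * g s).
  move=> f1 g1; under eq_bigr do rewrite sqrrB.
  rewrite !big_split/= f1 g1 sumrN sumrMnl; lra.
have D : \sum_j (U j - V j) ^+ 2 <= B ^+ 2.
  apply: le_trans uvB; rewrite sq// UV.
  under [leRHS]eq_bigr do rewrite sq//.
  rewrite -mulr_sumr ler_wpM2l//; apply: one_sub_prod_le => i.
  rewrite sumr_ge0 /= => [|t _]; last exact: mulr_ge0.
  have := sq _ _ _ (u1 i) (v1 i); have : 0 <= \sum_t (u i t - v i t) ^+ 2.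
    by apply: sumr_ge0 => t _; exact: sqr_ge0.
  lra.
have E : \sum_j (U j + V j) ^+ 2 <= 4.
  apply: (@le_trans _ _ (\sum_j (2 * U j ^+ 2 + 2 * V j ^+ 2))).
    by apply: ler_sum => j _; have := sqr_ge0 (U j - V j); lra.
  by rewrite big_split/= -!mulr_sumr U1 V1; lra.
(* Cauchy-Schwarz as a weighted arithmetic-geometric mean inequality, with the
   weight that balances the two norms *)
have amgm (a b : R) : a * b <= B^-1 * a ^+ 2 + B / 4 * b ^+ 2.
  have Bi : 0 <= B^-1 by rewrite invr_ge0 ltW.
  have := mulr_ge0 Bi (sqr_ge0 (a - B / 2 * b)).
  rewrite (_ : _ * (_ - _) ^+ 2 = B^-1 * a ^+ 2 + B / 4 * b ^+ 2 - a * b); last first.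
    by field; rewrite gt_eqF.
  lra.
apply: (@le_trans _ _ (\sum_j
    (B^-1 * (U j - V j) ^+ 2 + B / 4 * (U j + V j) ^+ 2))).
  apply: ler_sum => j _; rewrite !prodrXl -/(U j) -/(V j).
  rewrite subr_sqr normrM (ger0_norm (addr_ge0 (U0 j) (V0 j))).
  rewrite -(real_normK (num_real (U j - V j))).
  exact: amgm.
rewrite big_split/= -!mulr_sumr.
have : B^-1 * \sum_j (U j - V j) ^+ 2 <= B^-1 * B ^+ 2.
  by rewrite ler_wpM2l// invr_ge0 ltW.
have : B / 4 * \sum_j (U j + V j) ^+ 2 <= B / 4 * 4.
  by rewrite ler_wpM2l// divr_ge0// ltW.
rewrite expr2 mulrA mulVf ?gt_eqF// mul1r; lra.
Qed.

End hellinger.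

(** * A square-root partition of unity on the line *)

Section quarter_wave.
Context {R : realType}.

Lemma cos_lipschitz (a b : R) : `|cos a - cos b| <= `|a - b|.
Proof.
wlog ab : a b / a <= b => [hw|].
  by have [/hw//|/ltW/hw] := leP a b; rewrite distrC (distrC b).
have [c _ E] : exists2 c, c \in `[a, b] & cos b - cos a = - sin c * (b - a).
  apply: MVT_segment => //.
  by apply: continuous_subspaceT => x; exact: continuous_cos.
rewrite distrC E normrM normrN (distrC a) ler_piMl//.
by rewrite ler_norml sin_geN1 sin_le1.
Qed.

(** The square root of a bump function whose integer translates sum to 1.  It is
    the square root that has to be Lipschitz, since the Hellinger distance is an
    l_2 distance of square roots. *)
Definition quarter_wave (s : R) : R := cos (pi / 2 * Num.min `|s| 1).

Let pi2 : 0 <= (pi / 2 : R) <= 2.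
Proof. by have [] := pihalf_02_cos_pihalf R. Qed.

Lemma quarter_wave_ge0 s : 0 <= quarter_wave s.
Proof.
have /andP[p0 p2] := pi2.
have m0 : 0 <= Num.min `|s| 1 by rewrite le_min normr_ge0 ler01.
have m1 : Num.min `|s| 1 <= 1 by rewrite ge_min lexx orbT.
apply: cos_ge0_pihalf; apply/andP; split.
  by apply: (@le_trans _ _ 0); [rewrite oppr_le0|rewrite mulr_ge0].
by rewrite -[leRHS]mulr1 ler_wpM2l.
Qed.

Lemma quarter_wave_eq0 s : 1 <= `|s| -> quarter_wave s = 0.
Proof. by move=> s1; rewrite /quarter_wave min_r// mulr1 cos_pihalf. Qed.

Lemma quarter_wave_lipschitz s t :
  `|quarter_wave s - quarter_wave t| <= 2 * `|s - t|.
Proof.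
have /andP[p0 p2] := pi2.
apply: le_trans (cos_lipschitz _ _) _.
rewrite -mulrBr normrM (ger0_norm p0) ler_pM// (le_trans _ (ler_dist_dist s t))//.
move: `|s| `|t| => a b; rewrite !minEle.
by case: (leP a 1) => a1; case: (leP b 1) => b1;
  rewrite ?subrr ?normr0//; rewrite !ler_norml;
  case: (ger0P (a - b)) => ?; lra.
Qed.

Lemma quarter_wave_sqr s : 0 <= s -> s <= 1 ->
  quarter_wave s ^+ 2 + quarter_wave (s - 1) ^+ 2 = 1.
Proof.
move=> s0 s1; rewrite /quarter_wave ger0_norm// min_l// ler0_norm ?subr_le0//.
rewrite min_l; last by lra.
have -> : pi / 2 * - (s - 1) = - (pi / 2 * s - pi / 2) :> R by ring.
by rewrite cosN cosBpihalf cos2Dsin2.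
Qed.

End quarter_wave.

Section window.
Context {R : realType}.

(** Turns a sum over the integers with finitely many nonzero terms into a sum over
    a finite type, as is needed to expand a product of such sums. *)
Definition of_window N (t : 'I_(2 * N).+1) : int := t%:Z - N%:Z.

Lemma sum_window N (k : int) (g : int -> R) :
  (- N%:Z <= k)%R -> (k + 1 <= N%:Z)%R ->
  (forall j, j != k -> j != k + 1 -> g j = 0) ->
  \sum_(t < (2 * N).+1) g (of_window t) = g k + g (k + 1).
Proof.
move=> kN k1N gk.
have t1P : (absz (k + N%:Z)%R < (2 * N).+1)%N by lia.
have t2P : (absz (k + 1 + N%:Z)%R < (2 * N).+1)%N by lia.
rewrite (bigD1 (Ordinal t1P))//= (bigD1 (Ordinal t2P))/=; last first.
  by rewrite -val_eqE/=; lia.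
rewrite big1 ?addr0 => [|t /andP[]].
  by congr (g _ + g _); rewrite /of_window/=; lia.
rewrite -!val_eqE/= => t1 t2; apply: gk; rewrite /of_window; lia.
Qed.

Lemma of_window_inj N : injective (@of_window N).
Proof. by move=> s t /addIr[] /val_inj. Qed.

Lemma of_window_surj N (k : int) : (- N%:Z <= k <= N%:Z)%R ->
  exists t : 'I_(2 * N).+1, of_window t = k.
Proof.
move=> kN; have tP : (absz (k + N%:Z)%R < (2 * N).+1)%N by lia.
by exists (Ordinal tP); rewrite /of_window/=; lia.
Qed.

Let floorN N (x : R) : `|x| + 1 <= N%:R ->
  (- N%:Z <= Num.floor x)%R /\ (Num.floor x + 1 <= N%:Z)%R.
Proof.
move=> xN; have := floor_le x; have := floorD1_gt x.
rewrite intrD; have := ler_norm x; have := ler_norm (- x); rewrite normrN.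
move=> h1 h2 h3 h4; split.
  rewrite -ltzD1 -(ltr_int R) intrD intrN/= -[_%:~R]/(N%:R); lra.
rewrite -(ler_int R) intrD -[N%:Z%:~R]/(N%:R); lra.
Qed.

Let wave_floor (x : R) (j : int) : j != Num.floor x -> j != Num.floor x + 1 ->
  quarter_wave (x - j%:~R) = 0.
Proof.
move=> j1 j2; apply: quarter_wave_eq0.
have [h|h] : (j + 1 <= Num.floor x)%R \/ (Num.floor x + 1 + 1 <= j)%R by lia.
- rewrite ger0_norm; have := floor_le x; move: h; rewrite -(ler_int R) intrD; lra.
- rewrite ler0_norm; have := floorD1_gt x; move: h;
    rewrite -(ler_int R) !intrD; lra.
Qed.

Lemma sum_quarter_wave_sqr N (x : R) : `|x| + 1 <= N%:R ->
  \sum_(t < (2 * N).+1) quarter_wave (x - (of_window t)%:~R) ^+ 2 = 1.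
Proof.
move=> /floorN[l u].
rewrite (sum_window (g := fun j => quarter_wave (x - j%:~R) ^+ 2) l u); last first.
  by move=> j j1 j2; rewrite wave_floor// expr0n.
rewrite intrD opprD addrA quarter_wave_sqr//.
  by rewrite subr_ge0 floor_le.
by have := floorD1_gt x; rewrite intrD; lra.
Qed.

(** At most four terms are nonzero, two near [x] and two near [y], and each is at
    most [4 (x - y)^2], as [quarter_wave] is 2-Lipschitz. *)
Lemma sum_quarter_wave_var N (x y : R) : `|x| + 1 <= N%:R -> `|y| + 1 <= N%:R ->
  \sum_(t < (2 * N).+1)
    (quarter_wave (x - (of_window t)%:~R) - quarter_wave (y - (of_window t)%:~R))
      ^+ 2 <= (4 * (x - y)) ^+ 2.
Proof.
move=> /floorN[lx ux] /floorN[ly uy].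
pose near (z : R) (j : int) : R :=
  ((j == Num.floor z) || (j == Num.floor z + 1))%:R.
have near_sum z : (- N%:Z <= Num.floor z)%R -> (Num.floor z + 1 <= N%:Z)%R ->
    \sum_(t < (2 * N).+1) near z (of_window t) = 2.
  move=> l u; rewrite (sum_window l u) /near ?eqxx ?orbT// => j.
  by move=> /negPf-> /negPf->.
apply: (@le_trans _ _ (\sum_(t < (2 * N).+1)
    4 * (x - y) ^+ 2 * (near x (of_window t) + near y (of_window t)))); last first.
  rewrite -mulr_sumr big_split/= !near_sum//; lra.
apply: ler_sum => t _; move: (of_window t) => j.
have := quarter_wave_lipschitz (x - j%:~R) (y - j%:~R).
rewrite opprB addrA subrK => h.
have {}h : (quarter_wave (x - j%:~R) - quarter_wave (y - j%:~R)) ^+ 2 <=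
    4 * (x - y) ^+ 2.
  rewrite -(real_normK (num_real (_ - _))) -(real_normK (num_real (x - y))).
  rewrite (_ : 4 * _ = (2 * `|x - y|) ^+ 2); last by ring.
  by rewrite ler_pXn2r ?nnegrE// mulr_ge0.
have d0 : 0 <= 4 * (x - y) ^+ 2 by rewrite mulr_ge0// sqr_ge0.
have [jx|jx] := boolP ((j == Num.floor x) || (j == Num.floor x + 1)).
  by apply: (le_trans h); rewrite ler_peMr// /near jx lerDl.
have [jy|jy] := boolP ((j == Num.floor y) || (j == Num.floor y + 1)).
  by apply: (le_trans h); rewrite ler_peMr// /near jy lerDr.
move: jx jy; rewrite !negb_or => /andP[? ?] /andP[? ?].
rewrite !wave_floor// subrr expr0n/= mulr_ge0// /near addr_ge0//.
Qed.

End window.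

(** * Lattice weights and the l_p norms *)

Section lattice.
Context {R : realType} (n : nat).
Implicit Types (x y : 'I_n -> R) (j : {ffun 'I_n -> int}).

Definition lattice_weight x j : R :=
  \prod_i quarter_wave (x i - (j i)%:~R) ^+ 2.

Lemma lattice_weight_ge0 x j : 0 <= lattice_weight x j.
Proof. by apply: prodr_ge0 => i _; exact: sqr_ge0. Qed.

Lemma lattice_weight_supp x j i : lattice_weight x j != 0 ->
  `|x i - (j i)%:~R| <= 1.
Proof.
apply: contraNT; rewrite -ltNge => /ltW xj.
by rewrite /lattice_weight (bigD1 i)//= quarter_wave_eq0// expr0n mul0r.
Qed.

(** All indices of nonzero weight lie in a finite cube of the lattice.  There
    [lattice_weight x] and [lattice_weight y] are product probability measures
    whose factors have squared Hellinger distance at most [16 (x i - y i)^2]. *)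
Lemma lattice_weight_var x y (B : R) :
  0 <= B -> \sum_i (x i - y i) ^+ 2 <= B ^+ 2 ->
  exists D : seq {ffun 'I_n -> int},
    [/\ uniq D,
        forall j, j \notin D -> lattice_weight x j = 0 /\ lattice_weight y j = 0,
        \sum_(j <- D) lattice_weight x j = 1,
        \sum_(j <- D) lattice_weight y j = 1 &
        \sum_(j <- D) `|lattice_weight x j - lattice_weight y j| <= 8 * B].
Proof.
move=> B0 xyB.
pose N := Num.bound (\sum_i (`|x i| + `|y i|) + 1).
have xyN i : `|x i| + `|y i| + 1 <= N%:R.
  apply: (@le_trans _ _ (\sum_i (`|x i| + `|y i|) + 1)); last first.
    by apply/ltW/archi_boundP; rewrite addr_ge0// sumr_ge0// => ? _; exact: addr_ge0.
  rewrite lerD2r (bigD1 i)//= lerDl sumr_ge0// => ? _; exact: addr_ge0.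
have xN i : `|x i| + 1 <= N%:R by have := xyN i; have := normr_ge0 (y i); lra.
have yN i : `|y i| + 1 <= N%:R by have := xyN i; have := normr_ge0 (x i); lra.
pose emb (t : {ffun 'I_n -> 'I_(2 * N).+1}) := [ffun i => of_window (t i)].
have sum1 z : (forall i, `|z i| + 1 <= N%:R) ->
    \sum_(t : {ffun 'I_n -> 'I_(2 * N).+1}) lattice_weight z (emb t) = 1.
  move=> zN.
  under eq_bigr => t _.
    rewrite /lattice_weight; under eq_bigr do rewrite ffunE.
    over.
  rewrite -(bigA_distr_bigA (fun i t => quarter_wave (z i - (of_window t)%:~R) ^+ 2)).
  by rewrite big1// => i _; exact: sum_quarter_wave_sqr.
have out z j : (forall i, `|z i| + 1 <= N%:R) -> j \notin map emb (enum {: _}) ->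
    lattice_weight z j = 0.
  move=> zN jD; apply/eqP; apply: contraNT jD => zj.
  have /choice[t tP] i : exists t : 'I_(2 * N).+1, of_window t = j i.
    apply: of_window_surj.
    have := lattice_weight_supp i zj; have := zN i.
    rewrite -!(ler_int R) intrN -[N%:Z%:~R]/(N%:R).
    have := ler_norm (z i); have := ler_norm (- z i); rewrite normrN => h1 h2 h3.
    by rewrite ler_norml => /andP[h4 h5]; apply/andP; split; lra.
  apply/mapP; exists [ffun i => t i]; first by rewrite mem_enum.
  by apply/ffunP => i; rewrite !ffunE.
exists (map emb (enum {: _})); split.
- rewrite map_inj_uniq ?enum_uniq// => s t /ffunP st; apply/ffunP => i.
  by have := st i; rewrite !ffunE => /of_window_inj.
- by move=> j jD; split; apply: out.
- by rewrite big_map big_enum/= sum1.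
- by rewrite big_map big_enum/= sum1.
- rewrite big_map big_enum/= (_ : 8 * B = 2 * (4 * B)); last by ring.
  under eq_bigr => t _.
    rewrite /lattice_weight; under eq_bigr do rewrite ffunE.
    under [X in _ - X]eq_bigr do rewrite ffunE.
    over.
  apply: (product_l1_le_hellinger
    (u := fun i t => quarter_wave (x i - (of_window t)%:~R))
    (v := fun i t => quarter_wave (y i - (of_window t)%:~R))).
  + by move=> *; exact: quarter_wave_ge0.
  + by move=> *; exact: quarter_wave_ge0.
  + by move=> i; exact: sum_quarter_wave_sqr.
  + by move=> i; exact: sum_quarter_wave_sqr.
  + by rewrite mulr_ge0.
  + apply: (@le_trans _ _ (\sum_i (4 * (x i - y i)) ^+ 2)).
      by apply: ler_sum => i _; exact: sum_quarter_wave_var.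
    under eq_bigr do rewrite exprMn.
    by rewrite -mulr_sumr exprMn ler_wpM2l// sqr_ge0.
Qed.

End lattice.

Section lp_norm_comparison.
Context {R : realType} (n : nat).
Implicit Types (z : 'rV[R]_n) (p : \bar R).

Lemma lp_norm_sumE z (r : R) : 0 < r ->
  \sum_i `|z 0 i| `^ r = lp_norm r%:E z `^ r.
Proof.
move=> r0; rewrite lp_norm.unlock -powRrM mulVf ?gt_eqF// powRr1//.
by apply: sumr_ge0 => i _; exact: powR_ge0.
Qed.

Lemma coord_le_lp_norm z p i : (1 <= p)%E -> `|z 0 i| <= lp_norm p z.
Proof.
case: p => [r| |] //; last first.
  move=> _; rewrite lp_norm.unlock.
  exact: (@le_bigmax _ _ _ 0 (fun i => `|z 0 i|) i).
rewrite lee_fin => r1; have r0 : 0 < r by exact: lt_le_trans r1.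
rewrite -[leLHS](powRr1 (normr_ge0 _)) -(divff (lt0r_neq0 r0)) powRrM lp_norm.unlock.
apply: ge0_ler_powR; rewrite ?nnegrE ?invr_ge0 ?powR_ge0 ?(ltW r0)//.
  by apply: sumr_ge0 => k _; exact: powR_ge0.
by rewrite (bigD1 i)//= lerDl sumr_ge0// => k _; exact: powR_ge0.
Qed.

Lemma lp_norm_le z p (h : R) : (1 <= p)%E -> 0 <= h ->
  (forall i, `|z 0 i| <= h) -> lp_norm p z <= n%:R `^ fine p^-1 * h.
Proof.
case: p => [r| |] //; last first.
  move=> _ h0 zh; rewrite invey/= powRr0 mul1r lp_norm.unlock.
  exact: bigmax_le.
rewrite lee_fin => r1 h0 zh; have r0 : 0 < r by exact: lt_le_trans r1.
rewrite inver gt_eqF//= lp_norm.unlock.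
have -> : n%:R `^ r^-1 * h = (\sum_(i < n) h `^ r) `^ r^-1.
  rewrite sumr_const card_ord -[in RHS]mulr_natl powRM ?powR_ge0//.
  by rewrite -powRrM divff ?gt_eqF// powRr1.
apply: ge0_ler_powR; rewrite ?nnegrE ?invr_ge0 ?(ltW r0)//.
- by apply: sumr_ge0 => i _; exact: powR_ge0.
- by apply: sumr_ge0 => i _; exact: powR_ge0.
- by apply: ler_sum => i _; apply: ge0_ler_powR; rewrite ?nnegrE ?(ltW r0).
Qed.

(** For [p <= 2] the l_2 norm is at most the l_p norm; for [p >= 2] it is at most
    [n^(1/2 - 1/p)] times the l_p norm, by the power mean inequality. *)
Lemma sum_sqr_le_lp_norm z p : (0 < n)%N -> (1 <= p)%E ->
  n%:R `^ (2 * fine p^-1) * (\sum_i z 0 i ^+ 2) <=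
    (n%:R `^ Num.max 2^-1 (fine p^-1) * lp_norm p z) ^+ 2.
Proof.
move=> n0 p1; have n1 : 1 <= n%:R :> R by rewrite ler1n.
have n00 : 0 <= n%:R :> R by exact: ler0n.
have nR0 : n%:R != 0 :> R by rewrite pnatr_eq0 -lt0n.
set N := lp_norm p z; have N0 : 0 <= N by exact: lp_norm_ge0.
have nsqr (t : R) : (n%:R `^ t) ^+ 2 = n%:R `^ (2 * t) :> R.
  by rewrite -powR_mulrn ?powR_ge0// -powRrM mulrC.
rewrite exprMn nsqr.
have sqE i : z 0 i ^+ 2 = `|z 0 i| `^ 2.
  by rewrite powR_mulrn// real_normK// num_real.
have [p2|p2] := leP p 2%:E.
  (* |z_i|^2 = |z_i|^(2 - p) |z_i|^p <= |z|_p^(2 - p) |z_i|^p *)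
  case: p p1 p2 @N N0 => [r| |] //; rewrite !lee_fin => r1 r2 N N0.
  have r0 : 0 < r by exact: lt_le_trans r1.
  rewrite inver gt_eqF//= max_r; last by rewrite lef_pV2 ?posrE.
  rewrite ler_wpM2l ?powR_ge0//.
  have -> : N ^+ 2 = N `^ (2 - r) * N `^ r.
    by rewrite -powR_mulrn// -powRD ?subrK// pnatr_eq0.
  rewrite /N -lp_norm_sumE// mulr_sumr; apply: ler_sum => i _.
  have -> : z 0 i ^+ 2 = `|z 0 i| `^ (2 - r) * `|z 0 i| `^ r.
    by rewrite sqE -powRD ?subrK// pnatr_eq0.
  rewrite ler_wpM2r ?powR_ge0// ge0_ler_powR ?nnegrE ?subr_ge0//.
  by rewrite coord_le_lp_norm.
case: p p1 p2 @N N0 => [r| |] // p1 p2 N N0; last first.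
  rewrite invey/= mulr0 powRr0 mul1r max_l ?invr_ge0//.
  rewrite divff// powRr1//.
  apply: (@le_trans _ _ (\sum_(i < n) N ^+ 2)).
    apply: ler_sum => i _; rewrite -(real_normK (num_real (z 0 i))).
    by rewrite ler_pXn2r ?nnegrE// coord_le_lp_norm.
  by rewrite sumr_const card_ord mulr_natl.
rewrite !(lee_fin, lte_fin) in p1 p2.
have r0 : 0 < r by exact: lt_le_trans p1.
rewrite inver gt_eqF//= max_l; last by rewrite lef_pV2 ?posrE// ltW.
rewrite divff// powRr1//.
have [N00|N00] := eqVneq N 0.
  have -> : z = 0 by apply: lp_norm_eq0 N00; rewrite lee_fin.
  rewrite big1 ?mulr0 ?mulr_ge0 ?sqr_ge0// => i _.
  by rewrite mxE expr0n.
have Npos : 0 < N by rewrite lt_neqAle eq_sym N00.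
set c := n%:R `^ (2 / r); have c0 : 0 < c by rewrite powR_gt0// ltr0n.
(* Young's inequality for [w `^ (2 / r)] and 1, where [w] is normalised so that its
   mean over the coordinates is 1 *)
have term i : c * (z 0 i ^+ 2 / N ^+ 2) <=
    2 / r * (n%:R * (`|z 0 i| `^ r / N `^ r)) + (1 - 2 / r).
  pose w := n%:R * (`|z 0 i| `^ r / N `^ r).
  have w0 : 0 <= w by rewrite !mulr_ge0// ?invr_ge0 ?powR_ge0.
  have -> : c * (z 0 i ^+ 2 / N ^+ 2) = w `^ (2 / r).
    rewrite /w !powRM ?invr_ge0 ?divr_ge0 ?powR_ge0//.
    rewrite -/c sqE; congr (_ * (_ * _)).
      by rewrite -powRrM mulrCA divff ?gt_eqF// mulr1.
    rewrite -(powR_mulrn 2 N0) -!powRN -powRrM; congr (_ `^ _).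
    by field; rewrite gt_eqF.
  rewrite -/w.
  have q0 : 0 < 1 - 2 / r by rewrite subr_gt0 ltr_pdivrMr// mul1r.
  have := @conjugate_powR R (w `^ (2 / r)) 1 (r / 2) ((1 - 2 / r)^-1).
  rewrite powR1 invrK mulr1 mul1r -powRrM.
  rewrite (_ : 2 / r * (r / 2) = 1) ?powRr1//; last by field; rewrite gt_eqF.
  rewrite invf_div (mulrC w); apply => //; last by ring.
  - exact: powR_ge0.
  - exact: divr_gt0.
  - by rewrite invr_gt0.
have : \sum_i c * (z 0 i ^+ 2 / N ^+ 2) <= n%:R.
  apply: (le_trans (ler_sum _ (fun i _ => term i))).
  rewrite big_split/= sumr_const card_ord -!mulr_sumr -mulr_suml.
  rewrite lp_norm_sumE// divff ?gt_eqF ?powR_gt0// -mulr_natl.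
  by rewrite le_eqVlt; apply/orP; left; apply/eqP; ring.
rewrite -mulr_sumr -mulr_suml mulrA ler_pdivrMr ?exprn_gt0//.
Qed.

End lp_norm_comparison.

(** The lattice has mesh [h = s n^(-1/p)], the largest for which a cube with side
    [2 h] around [x] stays within [s] of [x]. *)
Lemma lp_fuzzy_cover (R : realType) (n : nat) (p : \bar R) (p1 : (1 <= p)%E)
    (s : R) : (0 < n)%N -> 0 < s ->
  exists (J : choiceType) (y : J -> lp p1 n) (w : lp p1 n -> J -> R),
    fuzzy_cover (8 * n%:R `^ Num.max 2^-1 (fine p^-1)) s y w.
Proof.
move=> n0 s0; set q := fine p^-1; set m := Num.max _ _.
have nq0 : 0 < n%:R `^ q :> R by rewrite powR_gt0// ltr0n.
pose h := s / n%:R `^ q; have h0 : 0 < h by rewrite divr_gt0.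
pose J : choiceType := {ffun 'I_n -> int}.
pose y (j : J) : lp p1 n := \row_i (h * (j i)%:~R).
pose w (x : lp p1 n) (j : J) := lattice_weight (fun i => (x : 'rV_n) 0 i / h) j.
exists J, y, w; split => [x j|x j wj|x x'].
- exact: lattice_weight_ge0.
- have -> : s = n%:R `^ q * h by rewrite /h mulrC divfK ?gt_eqF.
  apply: lp_norm_le => //; first exact: ltW.
  move=> i; rewrite !mxE.
  have -> : (x : 'rV_n) 0 i - h * (j i)%:~R = h * ((x : 'rV_n) 0 i / h - (j i)%:~R).
    by field; rewrite gt_eqF.
  rewrite normrM (gtr0_norm h0) ler_piMr ?(ltW h0)//.
  exact: (lattice_weight_supp i wj).
pose d := lp_norm p ((x : 'rV_n) - x').
have [||D [uD sD x1 x'1 var]] := @lattice_weight_var R n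
    (fun i => (x : 'rV_n) 0 i / h) (fun i => (x' : 'rV_n) 0 i / h)
    (n%:R `^ m * d / s).
- by rewrite divr_ge0 ?(ltW s0)// mulr_ge0 ?powR_ge0// lp_norm_ge0.
- under eq_bigr do rewrite -mulrBl exprMn.
  rewrite -mulr_suml -[leRHS]mulr1 /h.
  have := sum_sqr_le_lp_norm ((x : 'rV_n) - x') n0 p1; rewrite -/d -/q -/m.
  under eq_bigr do rewrite !mxE.
  set S := \sum_i _ => hS.
  have -> : S * (s / n%:R `^ q)^-1 ^+ 2 = n%:R `^ (2 * q) * S / s ^+ 2.
    rewrite (mulrC 2 q) powRrM powR_mulrn ?powR_ge0//.
    by field; rewrite !gt_eqF.
  by rewrite expr_div_n mulr1 ler_pM2r ?invr_gt0 ?exprn_gt0.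
exists D; split=> //.
have -> : 8 * n%:R `^ m * mdist x x' = s * (8 * (n%:R `^ m * d / s)).
  by rewrite -[mdist x x']/d; field; rewrite gt_eqF.
by rewrite ler_pM2l.
Qed.

Theorem theorem18 (R : realType) :
  exists C : R, 0 < C /\
    forall (n : nat) (p : \bar R) (p1 : (1 <= p)%E), (0 < n)%N ->
      (lipschitz_extension_modulus (lp p1 n)
        <= (C * n%:R `^ Num.max 2^-1 (fine p^-1))%:E)%E.
Proof.
exists 800; split=> // n p p1 n0.
rewrite (_ : 800 * _ = 100 * (8 * n%:R `^ Num.max 2^-1 (fine p^-1))); last by ring.
apply: lipschitz_extension_modulus_le.
  have : 1 <= n%:R `^ Num.max 2^-1 (fine p^-1) :> R.
    rewrite -[leLHS](powRr0 n%:R) ler_powR ?ler1n//.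
    by rewrite le_max invr_ge0 ler0n.
  lra.
by move=> s s0; exact: lp_fuzzy_cover.
Qed.
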